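(* Consider problem (P) with $A$ and $D$ in canonical form. If the optimal value of (P) is bounded from below, then: 1. $\dim E_i\le2$ for $i=1,\ldots,p$, $\dim E_i=1$ for $i=p+1,\ldots,m$, and no Jordan block $J(\kappa_i,n_i)$ has a complex (non-real) pair of eigenvalues. 2. If $\dim E_i=2$ for some index $i$, let $r,r+1$ be the coordinates of the $i$th block, put $\lambda=\kappa_i$ (with $\kappa_i=0$ for $k<i\le p$), $e_1'=e_r$, $e_2'=e_{r+1}$, and $\pi=\tau_i\bar x_r\bar x_{r+1}$ for a feasible point $\bar x$ of (P). Then $\tau_i=1$ and one of the following holds: ($\lambda\le0$, $e_1'=0$, $e_2'\ne0$); ($\lambda=0$, $e_1'=0$, $e_2'=0$, $\pi\ge0$); ($\lambda<0$, $e_1'=0$, $e_2'=0$, $\pi=0$); ($\lambda=0$, $e_1'=0$, $e_2'=0$, $\pi<0$); ($\lambda<0$, $e_1'=0$, $e_2'=0$, $\pi\neq0$).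
   Context: Problem (P) is $\min\{f(x)=\tfrac12x^TDx+e^Tx \;:\; h(x)=\tfrac12x^TAx+b^Tx+c\le 0,\ x\in\mathbb R^n\}$, with $A,D$ real symmetric $n\times n$, $b,e\in\mathbb R^n$, $c\in\mathbb R$. Standing assumption: (P) is feasible, and the three conditions $A\succeq0$, $b\in\mathrm{Range}(A)$, $c=\frac12b^TA^+b$ ($A^+$ the Moore–Penrose pseudoinverse) do not all hold simultaneously; equivalently, there is $\bar x$ with $h(\bar x)<0$. Canonical form: $$A=\mathrm{diag}(\tau_1E_1,\ldots,\tau_kE_k,\tau_{k+1}E_{k+1},\ldots,\tau_pE_p,\tau_{p+1}F_{p+1},\ldots,\tau_mF_m,0,\ldots,0),$$ $$D=\mathrm{diag}(\tau_1E_1J(\kappa_1,n_1),\ldots,\tau_kE_kJ(\kappa_k,n_k),\tau_{k+1}F_{k+1},\ldots,\tau_pF_p,\tau_{p+1}E_{p+1},\ldots,\tau_mE_m,0,\ldots,0),$$ with $\tau_i=\pm1$ and corresponding blocks of equal size $n_i$. Here $E$ of size $q$ has entries $1$ where $r+s=q+1$ and $0$ elsewhere; $F$ of size $q$ has entries $1$ where $r+s=q+2$ and $0$ elsewhere; $J(\kappa,q)$ is a $q\times q$ real Jordan block: for real $\kappa$, $\kappa$ on the diagonal and $1$ on the superdiagonal; for a complex pair $a\pm b\mathrm i$, $b\ne0$, block bidiagonal with diagonal blocks $\begin{pmatrix} a & -b \\ b & a \end{pmatrix}$ and identity $2\times2$ blocks on the block superdiagonal. Note $E J(0,q)=F$.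 Normalization: the entries of $b$ corresponding to any $2\times2$ block pair of the form $(\tau_iE_i,\tau_iE_iJ(\kappa_i,2))$ with real $\kappa_i$ (including $(\tau_iE_i,\tau_iF_i)$ of size 2) are $0$. *)

(* Defs.v *)
From HB Require Import structures.
From mathcomp Require Import all_boot all_order all_algebra.
From mathcomp Require Import reals complex.

Set Implicit Arguments.
Unset Strict Implicit.
Unset Printing Implicit Defensive.

Import Order.TTheory GRing.Theory Num.Theory.
Local Open Scope ring_scope.

Section Quadratic.
Variables (R : realType) (n : nat).
Implicit Types (A P : 'M[R]_n) (u x : 'cV[R]_n).

Definition quad A u x : R :=
  2^-1 * (x^T *m A *m x) 0 0 + (u^T *m x) 0 0.

Definition psd A : Prop :=
  A^T = A /\ forall x, 0 <= (x^T *m A *m x) 0 0.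

Definition in_range A u : Prop := exists y : 'cV[R]_n, A *m y = u.

(* The four Penrose equations; every real matrix has exactly one such P.
   (MathComp's pinvmx is only a partial inverse on the row space, not the
   Moore-Penrose inverse.) *)
Definition moore_penrose A P : Prop :=
  [/\ A *m P *m A = A, P *m A *m P = P,
      (A *m P)^T = A *m P & (P *m A)^T = P *m A].

(* The constraint h(x) <= 0 with h(x) = quad A u x + c. *)
Definition feasible A u (c : R) x : Prop := quad A u x + c <= 0.

Definition bounded_below_on (f : 'cV[R]_n -> R) (S : 'cV[R]_n -> Prop) : Prop :=
  exists M : R, forall x, S x -> M <= f x.

End Quadratic.

Section Blocks.
Variable R : realType.

(* Ordinals are 0-based, so r.+1 and s.+1 are the usual 1-based indices. *)
Definition Emx (q : nat) : 'M[R]_q :=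
  \matrix_(r, s) ((r.+1 + s.+1 == q.+1)%N)%:R.

Definition Fmx (q : nat) : 'M[R]_q :=
  \matrix_(r, s) ((r.+1 + s.+1 == q.+2)%N)%:R.

Definition real_jordan (l : R) (q : nat) : 'M[R]_q :=
  \matrix_(r, s) (l *+ (r == s) + ((s : nat) == r.+1)%:R).

(* r./2 is the index of the 2x2 block containing row r and odd r tells which
   of its two rows it is; only meaningful when q is even. *)
Definition pair_jordan (a b : R) (q : nat) : 'M[R]_q :=
  \matrix_(r, s)
    if r./2 == s./2 then
      if odd r == odd s then a else if odd r then b else - b
    else ((s : nat) == r.+2)%:R.

(* A complex pair a +/- b i is given by either of its two members. *)
Definition jordan (kap : R[i]) (q : nat) : 'M[R]_q :=
  if complex.Im kap == 0 then real_jordan (complex.Re kap) q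
  else pair_jordan (complex.Re kap) (complex.Im kap) q.

End Blocks.

(* Blocks are numbered 0, ..., m-1 instead of 1, ..., m: the ranges 1..k,
   k+1..p, p+1..m become i < k, k <= i < p, p <= i.  The value of kap is used
   only for i < k.  The ambient dimension is n = \sum_i sz i + z, z being the
   number of trailing zeros. *)
Section Canonical.
Variables (R : realType) (m k p z : nat).
Variables (sz : 'I_m -> nat) (tau : 'I_m -> R) (kap : 'I_m -> R[i]).

Definition A_block (i : 'I_m) : 'M[R]_(sz i) :=
  tau i *: (if (i < p)%N then Emx R (sz i) else Fmx R (sz i)).

Definition D_block (i : 'I_m) : 'M[R]_(sz i) :=
  tau i *: (if (i < k)%N then Emx R (sz i) *m jordan (kap i) (sz i)
            else if (i < p)%N then Fmx R (sz i)
            else Emx R (sz i)).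

Definition canonical_A : 'M[R]_(\sum_i sz i + z) :=
  block_mx (\mxdiag_(i < m) A_block i) 0 0 0.

Definition canonical_D : 'M[R]_(\sum_i sz i + z) :=
  block_mx (\mxdiag_(i < m) D_block i) 0 0 0.

(* The coordinate, in the whole space, of the j-th coordinate (j = 0, 1, ...)
   of block i. *)
Definition bcoord (i : 'I_m) (j : 'I_(sz i)) : 'I_(\sum_i sz i + z) :=
  lshift z (tagnat.Rank i j).

Definition block_lambda (i : 'I_m) : R :=
  if (i < k)%N then complex.Re (kap i) else 0.

End Canonical.

Arguments bcoord {m} z {sz} i j.

(* Main.v *)
(* Walking along a line x + tv shows that v^T A v < 0 forces v^T D v >= 0.
   Vectors supported on at most three coordinates of a single block violate this
   implication as soon as the block is too large, has a non-real eigenvalue, or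
   has size two with tau = -1 or lambda > 0.  Two cases escape it: the block pair
   (F, E) of size two with tau = 1, which is excluded by moving from a Slater
   point, and the vanishing of e_1', which follows by moving to infinity along
   the hyperbola x_r x_{r+1} = const, where h does not change. *)
Require Import Defs.
From HB Require Import structures.
From mathcomp Require Import all_boot all_order all_algebra.
From mathcomp Require Import reals complex.
From mathcomp Require Import boolp ring lra zify.

Set Implicit Arguments.
Unset Strict Implicit.
Unset Printing Implicit Defensive.

Import Order.TTheory GRing.Theory Num.Theory.
Local Open Scope ring_scope.

(** * Inequalities for real polynomials in one and two variables *)

Lemma quadratic_eventually_neg (R : realFieldType) (a l c : R) : a < 0 ->
  exists T, forall t, T <= t -> a * t ^+ 2 + l * t + c < 0.
Proof.
(* Beyond this threshold [- a * t ^+ 2] is at least [- a * t + (]|l| + [|c|) * t], which dominates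
   the lower-order terms since [t] is at least 1. *)
move=> a0; exists (1 + (`|l| + `|c|) / - a) => t tT.
have d0 : 0 <= (`|l| + `|c|) / - a.
  by rewrite divr_ge0 ?addr_ge0 // oppr_ge0 ltW.
have aE : (`|l| + `|c|) / - a * - a = `|l| + `|c|.
  by rewrite divfK // oppr_eq0 lt_eqF.
move: d0 aE tT; set d := _ / _ => d0 aE tT.
have := ler_norm l; have := ler_norm c; have := normr_ge0 c => c0 cn ln.
have : 0 <= - a * t * (t - (1 + d)).
  by rewrite mulr_ge0 ?subr_ge0 // mulr_ge0 //; lra.
have : l * t <= `|l| * t by rewrite ler_wpM2r //; lra.
have : `|c| * 1 <= `|c| * t by rewrite ler_wpM2l //; lra.
have := congr1 (fun y => t * y) aE; rewrite expr2; nra.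
Qed.

Lemma linear_unbounded (R : realFieldType) (l c M : R) :
  (forall t, M <= l * t + c) -> l = 0.
Proof.
move=> h; apply/eqP; apply: contraT => l0.
by have := h ((M - c - 1) / l); rewrite mulrC divfK //; lra.
Qed.

Lemma lead_coef_ge0 (R : realFieldType) (a l c : R) :
  (forall t, 0 < t -> 0 <= a * t ^+ 2 + l * t + c) -> 0 <= a.
Proof.
move=> h; rewrite leNgt; apply/negP => /quadratic_eventually_neg-/(_ l c)[T hT].
have /hT : T <= Num.max 1 T by rewrite le_max lexx orbT.
by have /h : 0 < Num.max 1 T; rewrite ?lt_max ?ltr01 //; lra.
Qed.

Lemma lin_coef_eq0 (R : realFieldType) (a l : R) :
  (forall t, 0 <= a * t ^+ 2 + l * t) -> l = 0.
Proof.
(* For [d] equal to 1 or -1, evaluating at [d / t] and multiplying by the cube of [t] makes [d * l]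
   a leading coefficient. *)
move=> h; have pos (d : R) : d ^+ 2 = 1 -> 0 <= d * l.
  move=> d2; apply: (@lead_coef_ge0 _ _ a 0) => t t0.
  have := h (d / t); rewrite -(@pmulr_rge0 _ (t ^+ 2)) ?exprn_gt0 //.
  have -> : t ^+ 2 * (a * (d / t) ^+ 2 + l * (d / t)) = a * d ^+ 2 + d * l * t.
    by field; lra.
  rewrite d2 => h'; have := mulr_ge0 (ltW t0) h'; lra.
have := pos 1; have := pos (-1); rewrite sqrrN expr1n; lra.
Qed.

(** Models a size-two pair (F, E) at a Slater point. If [b1] is nonzero, [t = b1 - u] gives
    constraint and objective the same slope in [s], so both can be driven down together. If
    [b1 = 0], then [s] is free and the slope [u + t] must vanish at every admissible [t]; strictness
    of [h0 < 0] admits two such [t]. *)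
Lemma parabola_unbounded (R : realFieldType) (h0 b1 b2 f0 u w N : R) : h0 < 0 ->
  (forall s t, h0 + s * b1 + t * b2 + 2^-1 * t ^+ 2 <= 0 ->
     N <= f0 + s * u + t * w + s * t) -> False.
Proof.
move=> h00 H; have [b10|b10] := eqVneq b1 0; last first.
  pose t := b1 - u.
  pose y := Num.min (- (h0 + t * b2 + 2^-1 * t ^+ 2)) (N - f0 - t * w - 1).
  have yl : y <= - (h0 + t * b2 + 2^-1 * t ^+ 2) by rewrite ge_min lexx.
  have yr : y <= N - f0 - t * w - 1 by rewrite ge_min lexx orbT.
  have yb : y / b1 * b1 = y by rewrite divfK.
  have yu : y / b1 * u + y / b1 * t = y by rewrite -mulrDr /t addrC subrK.
  have := H (y / b1) t; rewrite yb => /(_ ltac:(lra)); lra.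
have uE t : h0 + t * b2 + 2^-1 * t ^+ 2 <= 0 -> u + t = 0.
  move=> ht; apply: (@linear_unbounded _ _ (f0 + t * w) N) => s.
  have := H s t; rewrite b10 mulr0 addr0 => /(_ ht); lra.
have u0 : u = 0 by have := uE 0; rewrite expr0n /=; lra.
have k0 : 0 < 1 + `|b2| - h0 by have := normr_ge0 b2; lra.
pose d := - h0 / (1 + `|b2| - h0).
have d0 : 0 < d by rewrite divr_gt0 // oppr_gt0.
have dE : d * (1 + `|b2| - h0) = - h0 by rewrite divfK ?lt0r_neq0.
have d1 : d < 1 by rewrite ltr_pdivrMr // ; have := normr_ge0 b2; lra.
have db : d * b2 <= d * `|b2| by rewrite ler_pM2l // ler_norm.
have dd : d ^+ 2 <= d by rewrite expr2 ler_piMr // ltW.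
have dh : d * h0 <= 0 by rewrite pmulr_rle0 // ltW.
by have := uE d ltac:(rewrite !mulrDr in dE; lra); lra.
Qed.

(** In the moved coordinates X = x1 + s and Y = x2 + t, the constraint and the [l] term depend only
    on XY. Keeping XY = x1 x2 while X tends to infinity leaves [e1] X as the only unbounded term of
    the objective. *)
Lemma hyperbola_bounded (R : realFieldType) (x1 x2 l e1 e2 f0 h0 N : R) : h0 <= 0 ->
  (forall s t, h0 + s * x2 + t * x1 + s * t <= 0 ->
     N <= f0 + s * (l * x2 + e1) + t * (l * x1 + x2 + e2) + 2^-1 * t ^+ 2
          + l * (s * t)) -> e1 = 0.
Proof.
move=> h00 H; pose P := x1 * x2.
(* Collects the bounds of all terms except [e1 * X], using that [|Y|] is at most [|P|] once [|X|] is
   at least 1. *)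
pose C := f0 - e1 * x1 - e2 * x2 - 2^-1 * x2 ^+ 2 + `|e2| * `|P| + 2^-1 * P ^+ 2.
have bnd X : 1 <= `|X| -> N <= C + e1 * X.
  move=> X1; have X0 : X != 0 by rewrite -normr_gt0; lra.
  have XY : X * (P / X) = P by rewrite mulrC divfK.
  have YP : `|P / X| <= `|P|.
    by rewrite normrM normfV ler_pdivrMr ?ler_peMr //; lra.
  have := H (X - x1) (P / X - x2).
  move: XY YP; set Y := P / X => XY YP.
  have -> : h0 + (X - x1) * x2 + (Y - x2) * x1 + (X - x1) * (Y - x2) = h0.
    by rewrite -[RHS]addr0 -[X in _ = _ + X](subrr P) -{1}XY /P; ring.
  move/(_ h00).
  have eY : e2 * Y <= `|e2| * `|P|.
    apply: le_trans (ler_norm _) _; rewrite normrM.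
    exact: ler_wpM2l.
  have Y2 : Y ^+ 2 <= P ^+ 2.
    by rewrite -[Y ^+ 2]real_normK ?num_real // -[P ^+ 2]real_normK ?num_real //
       ler_sqr ?nnegrE.
  have lXY : l * (X * Y) = l * (x1 * x2) by rewrite XY.
  rewrite /C; lra.
apply/eqP; apply: contraT => e10.
have ne : 0 < `|e1| by rewrite normr_gt0.
have [T hT] := @quadratic_eventually_neg _ (- e1 ^+ 2) 0 (C - N)
  ltac:(by rewrite oppr_lt0 exprn_even_gt0).
(* The point used is [X = - e1 * S ^+ 2]: its sign makes [e1 * X] very negative, and the second
   bound on [S] ensures that [|X|] is at least 1. *)
pose S := Num.max T (1 + `|e1|^-1).
have S1 : 1 + `|e1|^-1 <= S by rewrite le_max lexx orbT.
have := hT S; rewrite le_max lexx => /(_ isT).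
have eS : 1 <= `|e1| * S.
  have : `|e1| * (1 + `|e1|^-1) <= `|e1| * S by rewrite ler_pM2l.
  rewrite mulrDr mulfV ?lt0r_neq0 //; lra.
have e1i : 0 < `|e1|^-1 by rewrite invr_gt0.
have S0 : 1 <= S by lra.
have := bnd (- e1 * S ^+ 2).
rewrite normrM normrN normrX (ger0_norm (x := S)); last lra.
by move/(_ ltac:(nra)); nra.
Qed.

(** * Bilinear forms and quadratic functions along lines *)

Section Forms.
Variable R : realType.

Definition bilin n (M : 'M[R]_n) (x y : 'cV[R]_n) : R := (x^T *m M *m y) 0 0.

Definition basis n (j : 'I_n) : 'cV[R]_n := delta_mx j 0.

Variable n : nat.
Implicit Types (M A D : 'M[R]_n) (x y v u : 'cV[R]_n).

Lemma bilinDl M x y v : bilin M (x + y) v = bilin M x v + bilin M y v.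
Proof. by rewrite /bilin linearD /= !mulmxDl mxE. Qed.

Lemma bilinDr M x y v : bilin M v (x + y) = bilin M v x + bilin M v y.
Proof. by rewrite /bilin mulmxDr mxE. Qed.

Lemma bilinZl M a x y : bilin M (a *: x) y = a * bilin M x y.
Proof. by rewrite /bilin linearZ /= -!scalemxAl mxE. Qed.

Lemma bilinZr M a x y : bilin M x (a *: y) = a * bilin M x y.
Proof. by rewrite /bilin -scalemxAr mxE. Qed.

Lemma bilin_basisl M j x : bilin M (basis j) x = (M *m x) j 0.
Proof. by rewrite /bilin /basis trmx_delta -mulmxA -rowE mxE. Qed.

Lemma bilin_basisr M j x : bilin M x (basis j) = (M^T *m x) j 0.
Proof. by rewrite /bilin /basis -colE mxE -[x^T *m M]trmxK trmx_mul trmxK mxE. Qed.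

Lemma bilin_basis M i j : bilin M (basis i) (basis j) = M i j.
Proof. by rewrite bilin_basisl /basis -colE mxE. Qed.

Lemma dot_basisZ u j t : (u^T *m (t *: basis j)) 0 0 = t * u j 0.
Proof. by rewrite -scalemxAr /basis -colE !mxE. Qed.

Lemma quadD M u x v :
  quad M u (x + v) = quad M u x + 2^-1 * (bilin M x v + bilin M v x)
    + 2^-1 * bilin M v v + (u^T *m v) 0 0.
Proof.
rewrite /quad -!/(bilin _ _ _) bilinDl !bilinDr mulmxDr mxE; ring.
Qed.

Lemma quad_line M u x v : exists l, forall t,
  quad M u (x + t *: v) = 2^-1 * bilin M v v * t ^+ 2 + l * t + quad M u x.
Proof.
exists (2^-1 * (bilin M x v + bilin M v x) + (u^T *m v) 0 0) => t.
by rewrite quadD !bilinZl !bilinZr -scalemxAr mxE; ring.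
Qed.

Lemma curvature_ge0 A D b e c v :
  bounded_below_on (quad D e) (feasible A b c) ->
  bilin A v v < 0 -> 0 <= bilin D v v.
Proof.
move=> [N hN] Av; rewrite leNgt; apply/negP => Dv.
have [lA hA] := quad_line A b 0 v; have [lD hD] := quad_line D e 0 v.
have [T hT] := @quadratic_eventually_neg _ (2^-1 * bilin A v v) lA
  (quad A b 0 + c) ltac:(lra).
have [T' hT'] := @quadratic_eventually_neg _ (2^-1 * bilin D v v) lD
  (quad D e 0 - N) ltac:(lra).
have le1 : T <= Num.max T T' by rewrite le_max lexx.
have le2 : T' <= Num.max T T' by rewrite le_max lexx orbT.
have f1 := hT _ le1; have f2 := hT' _ le2.
have /hN : feasible A b c (0 + Num.max T T' *: v).
  by rewrite /feasible hA; lra.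
rewrite hD; lra.
Qed.

(** The quadratic form of [B] at a vector supported on coordinates [i], [j], [l]. The indices may
    coincide, so size-two blocks are covered by taking [w = 0]. *)
Definition form3 q (B : 'M[R]_q) (i j l : 'I_q) (x y w : R) : R :=
  B i i * x ^+ 2 + B j j * y ^+ 2 + B l l * w ^+ 2
  + (B i j + B j i) * (x * y) + (B i l + B l i) * (x * w)
  + (B j l + B l j) * (y * w).

Lemma bilin_form3 M i j l (x y w : R) :
  let v := x *: basis i + y *: basis j + w *: basis l in
  bilin M v v = form3 M i j l x y w.
Proof.
by rewrite /= !bilinDl !bilinDr !bilinZl !bilinZr !bilin_basis /form3; ring.
Qed.

End Forms.

(** * Block-diagonal matrices padded with zeros *)

Section PaddedDiagonal.
Variables (R : realType) (m z : nat) (sz : 'I_m -> nat).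
Implicit Types (B C : forall i, 'M[R]_(sz i)) (i : 'I_m).

(** The common shape of [canonical_A] and [canonical_D], convertible to both. *)
Definition pad_diag B : 'M[R]_(\sum_i sz i + z) :=
  block_mx (\mxdiag_(i < m) B i) 0 0 0.

Lemma pad_diag_tr B : (pad_diag B)^T = pad_diag (fun i => (B i)^T).
Proof. by rewrite /pad_diag tr_block_mx tr_mxdiag !trmx0. Qed.

Lemma pad_diag_mul B C :
  pad_diag B *m pad_diag C = pad_diag (fun i => B i *m C i).
Proof.
rewrite /pad_diag mulmx_block !mulmx0 !mul0mx !addr0 mul_mxblock_mxdiag.
congr block_mx; apply/eq_mxblock => i j.
by case: eqP => [e|_]; rewrite ?mul0mx //; case: _ / e; rewrite !conform_mx_id.
Qed.

Lemma eq_pad_diag B C : (forall i, B i = C i) -> pad_diag B = pad_diag C.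
Proof. by move=> h; rewrite /pad_diag; congr block_mx; apply/eq_mxdiag. Qed.

Lemma pad_diagE B i (r s : 'I_(sz i)) :
  pad_diag B (bcoord z i r) (bcoord z i s) = B i r s.
Proof.
by rewrite /pad_diag /bcoord block_mxEul -(submxblock_diag B i) [RHS]mxE.
Qed.

Lemma pad_diag_mulv B (x : 'cV[R]_(\sum_i sz i + z)) i (r : 'I_(sz i)) :
  (pad_diag B *m x) (bcoord z i r) 0 =
  \sum_s B i r s * x (bcoord z i s) 0.
Proof.
rewrite -[x]vsubmxK -[usubmx x]submxcolK /pad_diag mul_block_col !mul0mx !addr0.
rewrite mul_mxdiag_mxcol /bcoord col_mxEu.
transitivity ((B i *m submxcol (usubmx x) i) r 0).
  set C := fun i => _.
  by rewrite -[RHS]/(C i r 0) -(mxcolK C i) [RHS]mxE.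
rewrite mxE; apply: eq_bigr => s _; rewrite col_mxEu; congr (_ * _).
by rewrite -[in LHS](mxcolK (submxcol (usubmx x)) i) mxE.
Qed.

(** By block diagonality, a move inside one block interacts with [x] only through the coordinates of
    that block, here just two. *)
Lemma quad_pad_diag_pair B (u x : 'cV[R]_(\sum_i sz i + z)) i
    (r r' : 'I_(sz i)) (s t : R) :
  sz i = 2%N -> r = 0%N :> nat -> r' = 1%N :> nat -> B i r' r = B i r r' ->
  let x1 := x (bcoord z i r) 0 in let x2 := x (bcoord z i r') 0 in
  quad (pad_diag B) u
    (x + (s *: basis R (bcoord z i r) + t *: basis R (bcoord z i r'))) =
  quad (pad_diag B) u x
  + s * (B i r r * x1 + B i r r' * x2 + u (bcoord z i r) 0)
  + t * (B i r r' * x1 + B i r' r' * x2 + u (bcoord z i r') 0)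
  + 2^-1 * (B i r r * s ^+ 2 + B i r' r' * t ^+ 2) + B i r r' * (s * t).
Proof.
move=> q2 r0 r1 sym x1 x2.
have sum2 (F : 'I_(sz i) -> R) : \sum_s F s = F r + F r'.
  rewrite (bigD1 r) //= (bigD1 r') /=; last by rewrite -val_eqE /= r0 r1.
  rewrite big1 ?addr0 // => j /andP[]; rewrite -!val_eqE /= r0 r1 => ? ?.
  by have := ltn_ord j; lia.
have dot : (u^T *m (s *: basis R (bcoord z i r) + t *: basis R (bcoord z i r')))
    0 0 = s * u (bcoord z i r) 0 + t * u (bcoord z i r') 0.
  by rewrite mulmxDr mxE !dot_basisZ.
rewrite quadD dot !bilinDr !bilinDl !bilinZr !bilinZl !bilin_basis !pad_diagE.
rewrite !bilin_basisl !bilin_basisr pad_diag_tr !pad_diag_mulv !sum2 !mxE sym.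
by rewrite -/x1 -/x2; field.
Qed.

Lemma curvature_ge0_block B C (b e : 'cV[R]_(\sum_i sz i + z)) c i :
  bounded_below_on (quad (pad_diag C) e) (feasible (pad_diag B) b c) ->
  forall (r s t : 'I_(sz i)) (u v w : R),
    form3 (B i) r s t u v w < 0 -> 0 <= form3 (C i) r s t u v w.
Proof.
move=> bnd r s t u v w.
have pad_form3 E : form3 (E i) r s t u v w = form3 (pad_diag E)
    (bcoord z i r) (bcoord z i s) (bcoord z i t) u v w.
  by rewrite /form3 !pad_diagE.
by rewrite !pad_form3 -!bilin_form3; exact: (curvature_ge0 bnd).
Qed.

End PaddedDiagonal.

(** * Algebra of E, F and Jordan blocks, and what the curvature condition forces on them *)

Section Blocks.
Variable R : realType.

(* The second-order condition that boundedness from below imposes on a pair of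
   corresponding blocks of [A] and [D]; three coordinates suffice. *)
Definition curvature_cond q (A D : 'M[R]_q) := forall i j l (x y w : R),
  form3 A i j l x y w < 0 -> 0 <= form3 D i j l x y w.

Lemma Emx_mul q (M : 'M[R]_q) r s : (Emx R q *m M) r s = M (rev_ord r) s.
Proof.
rewrite mxE (bigD1 (rev_ord r)) //= !mxE big1 => [|j]; last first.
  rewrite -val_eqE /= => jr; rewrite !mxE.
  have -> : (r.+1 + j.+1 == q.+1)%N = false.
    by have := ltn_ord r; lia.
  by rewrite mul0r.
have -> : (r.+1 + (rev_ord r).+1 == q.+1)%N.
  by have := ltn_ord r; rewrite /=; lia.
by rewrite mul1r addr0.
Qed.

Lemma Emx_real_jordan q (l : R) :
  Emx R q *m real_jordan l q = l *: Emx R q + Fmx R q.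
Proof.
apply/matrixP => r s; rewrite Emx_mul !mxE -val_eqE /=.
have -> : (q - r.+1 == s)%N = (r.+1 + s.+1 == q.+1)%N.
  by have := ltn_ord r; lia.
have -> : (s == (q - r.+1).+1 :> nat) = (r.+1 + s.+1 == q.+2)%N.
  by have := ltn_ord r; lia.
by rewrite mulr_natr.
Qed.

Lemma tr_Emx q : (Emx R q)^T = Emx R q.
Proof. by apply/matrixP => r s; rewrite !mxE addnC. Qed.

Lemma tr_Fmx q : (Fmx R q)^T = Fmx R q.
Proof. by apply/matrixP => r s; rewrite !mxE addnC. Qed.

Lemma Emx_sq q : Emx R q *m Emx R q = 1%:M.
Proof.
apply/matrixP => r s; rewrite Emx_mul !mxE -val_eqE /=.
by congr (_%:R); have := ltn_ord r; have := ltn_ord s; lia.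
Qed.

(** In size [1 + q], F is block diagonal with blocks 0 and E, and E is an involution. *)
Lemma Fmx_cube q : Fmx R q *m Fmx R q *m Fmx R q = Fmx R q.
Proof.
case: q => [|q]; first by apply/matrixP => -[].
have cube (X : 'M[R]_(1 + q)) : X = block_mx 0 0 0 (Emx R q) -> X *m X *m X = X.
  move=> ->; rewrite !(mulmx_block, mul0mx, mulmx0, addr0, add0r) Emx_sq.
  by rewrite mul1mx.
apply: cube; apply/matrixP => r s.
case: (split_ordP (r : 'I_(1 + q))) => i ->;
  case: (split_ordP (s : 'I_(1 + q))) => j ->;
  rewrite ?block_mxEul ?block_mxEur ?block_mxEdl ?block_mxEdr !mxE /= ?ord1 //=;
  try (have := ltn_ord i; have := ltn_ord j; case: eqP => //; lia).
by congr (_%:R); lia.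
Qed.

Ltac eval_nat_eqs := repeat match goal with
  |- context [@eq_op _ ?a ?b] => first
    [ have -> : (a == b :> nat) = true by lia
    | have -> : (a == b :> nat) = false by lia ] end; rewrite /=.

(** Lets the values of both forms at a concrete vector be announced first and checked by computation
    afterwards. *)
Lemma curvature_instance (a a' d d' : R) : (a < 0 -> 0 <= d) ->
  a = a' -> d = d' -> a' < 0 -> 0 <= d'.
Proof. by move=> h <- <-. Qed.

Lemma curvature_real_size (q : nat) (t l : R) : t = 1 \/ t = -1 ->
  curvature_cond (t *: Emx R q) (t *: (l *: Emx R q + Fmx R q)) -> (q <= 2)%N.
Proof.
move=> t1; case: q => [|[|[|q]]] // cur; exfalso.
have q2 : (q.+2 < q.+3)%N by [].
(* E pairs the first coordinate with the last, F the second with the last. The first entry is tuned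
   to make the A-form -1; its [q == 0] correction cancels the middle diagonal entry of E in size
   three. The D-form is then [- l - 2 * M], which is negative. *)
pose M := `|l| + 1.
have := cur ord0 (Ordinal (isT : (1 < q.+3)%N)) (Ordinal q2)
  ((- M ^+ 2 * (q == 0)%:R - t) / 2) (- t * M) 1.
have := ler_norm (- l); rewrite normrN => ln; have := normr_ge0 l => l0.
move/(@curvature_instance _ (-1) _ (- l - 2 * M)) => h.
suff : 0 <= - l - 2 * M by rewrite /M; lra.
by apply: h; rewrite ?ltrN10 // /form3 !mxE /= {cur};
  case: q q2 => [|q] q2 /=; eval_nat_eqs; case: t1 => ->; field.
Qed.

Lemma curvature_FE_size (q : nat) (t : R) : t = 1 \/ t = -1 ->
  curvature_cond (t *: Fmx R q) (t *: Emx R q) -> (1 < q)%N -> q = 2%N /\ t = 1.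
Proof.
move=> t1; case: q => [|[|[|q]]] // cur _.
  split=> //; case: t1 => // t1.
  (* For [t = -1] the vector (1, 1) gives the A-form -1 and the D-form -2. *)
  have := cur ord0 ord_max ord_max 1 1 0.
  rewrite /form3 !mxE /= t1; lra.
exfalso; have q2 : (q.+2 < q.+3)%N by [].
(* The A-form is -2; the D-form is -4, or [-4 + t] in size three because of the middle diagonal
   entry of E. *)
have := cur ord0 (Ordinal (isT : (1 < q.+3)%N)) (Ordinal q2) 2 1 (-t).
rewrite /form3 !mxE /= {cur}.
by case: q q2 => [|q] q2 /=; eval_nat_eqs; case: t1 => ->; lra.
Qed.

Lemma form3Z q (t : R) (B : 'M[R]_q) i j l x y w :
  form3 (t *: B) i j l x y w = t * form3 B i j l x y w.
Proof. by rewrite /form3 !mxE; ring. Qed.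

Lemma curvature_complex (q : nat) (t a b : R) : t = 1 \/ t = -1 ->
  (0 < q)%N -> ~~ odd q ->
  curvature_cond (t *: Emx R q) (t *: (Emx R q *m pair_jordan a b q)) -> b = 0.
Proof.
move=> t1; case: q => [|[|[|[|q]]]] // _ oq cur.
  suff : 0 <= t * b /\ 0 <= - (t * b) by case: t1 => ->; lra.
  (* In size two, EJ has the form b x^2 + 2 a x y - b y^2. Letting x, respectively y, grow while
     keeping [t] x y negative isolates both signs of [t * b]. *)
  split; [apply: (@lead_coef_ge0 _ _ (- (2 * a)) (- (t * b))) |
          apply: (@lead_coef_ge0 _ _ (- (2 * a)) (t * b))] => N N0.
    have := cur ord0 ord_max ord_max N (- t) 0.
    move/(@curvature_instance _ (- (2 * N))); apply; last lra.
      by rewrite /form3 !mxE /=; case: t1 => ->; ring.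
    rewrite form3Z /form3 !Emx_mul !mxE /=.
    by case: t1 => ->; ring.
  have := cur ord0 ord_max ord_max 1 (- t * N) 0.
  move/(@curvature_instance _ (- (2 * N))); apply; last lra.
    by rewrite /form3 !mxE /=; case: t1 => ->; ring.
  rewrite form3Z /form3 !Emx_mul !mxE /=.
  by case: t1 => ->; ring.
have [j qE] : exists j, q = j.*2 by exists q./2; lia.
pose i1 := Ordinal (ltnW (leqnn q.+4) : (q.+2 < q.+4)%N).
pose d : R := (q == 0)%:R.
(* With entries [s], [y], [- t / s] at the first, penultimate and last coordinates, the A-form stays
   at -2 while the D-form is affine in the free [y], so its slope vanishes. The term [d] comes from
   the superdiagonal identity block, which is met only in size four. *)
have step (s : R) : s != 0 -> 2 * (t * b * s - d / s) = 0.
  move=> s0; apply: (@linear_unbounded _ _ (- 2 * a) 0) => y.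
  have := cur ord0 i1 ord_max s y (- t / s).
  move/(@curvature_instance _ (-2)); apply; last lra.
    rewrite /form3 !mxE /=; eval_nat_eqs.
    by case: t1 => ->; field.
  rewrite form3Z /form3 !Emx_mul !mxE /= /d qE.
  have -> : (j.*2.+4 - j.*2.+3 = 1)%N by lia.
  have -> : (j.*2.+4 - j.*2.+4 = 0)%N by lia.
  rewrite !doubleK !uphalf_double !odd_double !eqxx /=.
  by case: {+}j => [|j'] /=; eval_nat_eqs; case: t1 => ->; field.
have two : (2 : R) != 0 by rewrite pnatr_eq0.
(* Two values of [s] separate [t * b] from [d]. *)
have := step 1 (oner_neq0 _); have := step 2 two.
rewrite divr1.
by case: t1 => ->; lra.
Qed.

Lemma curvature_real_pair q (t l : R) : t = 1 \/ t = -1 -> q = 2%N ->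
  curvature_cond (t *: Emx R q) (t *: (l *: Emx R q + Fmx R q)) ->
  t = 1 /\ l <= 0.
Proof.
move=> t1 q2; subst q => cur.
have curE x y : t * (x * y) < 0 -> 0 <= t * (2 * l * (x * y) + y ^+ 2).
  move=> xy; have := cur ord0 ord_max ord_max x y 0.
  move/(@curvature_instance _ (2 * (t * (x * y)))); apply; last lra;
    by rewrite /form3 !mxE /=; ring.
have tE : t = 1.
  case: t1 => // tN; suff : (0 : R) <= -1 by lra.
  (* The vectors (1/N, N) keep the product of the two entries equal to 1, while the y^2 term of the
     D-form, with coefficient -1, grows. *)
  apply: (@lead_coef_ge0 _ _ 0 (- (2 * l))) => N N0.
  have := curE N^-1 N; rewrite tN mulVf; last lra.
  by move/(_ ltac:(lra)); lra.
split=> //; rewrite leNgt; apply/negP => l0.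
have li : 0 < l^-1 by rewrite invr_gt0.
have lK : l * l^-1 = 1 by rewrite mulfV; lra.
(* For positive [l] this vector gives D-form -2 + 1 = -1. *)
have := curE (- l^-1) 1; rewrite tE; move: li lK; set y := l^-1 => li lK.
by move/(_ ltac:(lra)); nra.
Qed.

(** Eigenvectors are row vectors here, and column [s] of the block involves only entries [s] and
    [s - 1]. If [w] differed from [l], the entries would vanish one after another from the left. *)
Lemma eigenvalue_real_jordan q (l : R) (w : R[i]) :
  eigenvalue (map_mx (real_complex R) (real_jordan l q)) w -> w = (l%:C)%C.
Proof.
move=> /eigenvalueP[v vJ v0]; apply/eqP; apply: contraNT v0 => wl.
suff vz n (s : 'I_q) : s = n :> nat -> v 0 s = 0.
  by apply/eqP/rowP => s; rewrite (vz s) // mxE.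
elim/ltn_ind: n s => n IH s sn.
have /rowP/(_ s) := vJ; rewrite !mxE (bigD1 s) //= big1 => [|j js].
  rewrite !mxE eqxx (ltn_eqF (ltnSn s)) addr0 mulr1n addr0 mulrC => /eqP.
  by rewrite -subr_eq0 -mulrBl mulf_eq0 subr_eq0 eq_sym (negPf wl) => /eqP.
rewrite !mxE (negPf js) mulr0n add0r; case: eqP => [sj|_]; last by rewrite mulr0.
by rewrite (IH j) ?mul0r // -sn sj.
Qed.

End Blocks.

(** * Existence of a Slater point for the canonical form *)

Lemma canonical_A_tr (R : realType) m p z (sz : 'I_m -> nat) (tau : 'I_m -> R) :
  (canonical_A p z sz tau)^T = canonical_A p z sz tau.
Proof.
rewrite (pad_diag_tr z); apply: eq_pad_diag => i.
by rewrite /A_block linearZ /=; case: ifP; rewrite (tr_Emx, tr_Fmx).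
Qed.

Lemma canonical_A_cube (R : realType) m p z (sz : 'I_m -> nat) (tau : 'I_m -> R) :
  (forall i, tau i = 1 \/ tau i = -1) ->
  let A := canonical_A p z sz tau in A *m A *m A = A.
Proof.
move=> tau_pm1 /=.
rewrite !(pad_diag_mul z); apply: eq_pad_diag => i; rewrite /A_block.
have cube q (M : 'M[R]_q) (t : R) : M *m M *m M = M -> t = 1 \/ t = -1 ->
  t *: M *m (t *: M) *m (t *: M) = t *: M.
  by move=> MMM [->|->]; rewrite ?scale1r // !scaleN1r !(mulNmx, mulmxN) opprK MMM.
case: ifP => _; apply: cube (tau_pm1 i); last exact: Fmx_cube.
by rewrite Emx_sq mul1mx.
Qed.

(* With [A *m A *m A = A], the matrix [A] is its own Moore-Penrose inverse. *)
Lemma slater_point (R : realType) n (A : 'M[R]_n) (b : 'cV[R]_n) c :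
  A^T = A -> A *m A *m A = A ->
  (exists x, feasible A b c x) ->
  (forall Ap, moore_penrose A Ap ->
     ~ [/\ psd A, in_range A b & c = 2^-1 * (b^T *m Ap *m b) 0 0]) ->
  exists x, quad A b x + c < 0.
Proof.
move=> As A3 [x fx] nondeg; apply: contrapT => /forallNP hge.
have {}hge y : 0 <= quad A b y + c by rewrite leNgt; apply/negP; exact: hge.
(* Without a Slater point h is nonnegative, so the feasible [x] is a minimizer with value 0. Its
   vanishing gradient Ax + b and the second-order condition yield the excluded degenerate case. *)
have hx : quad A b x + c = 0 by apply/eqP; rewrite eq_le hge andbT.
have AxE : A *m x = - b.
  apply/colP => j; rewrite [RHS]mxE; apply/eqP; rewrite -addr_eq0; apply/eqP.
  apply: (@lin_coef_eq0 _ (2^-1 * A j j)) => t.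
  have := hge (x + t *: basis R j).
  rewrite quadD !bilinZl !bilinZr bilin_basis bilin_basisl bilin_basisr As.
  rewrite dot_basisZ.
  by move/le_trans; apply; rewrite le_eqVlt; apply/orP; left; apply/eqP;
    rewrite -[RHS]addr0 -hx; field.
apply: (nondeg A); first by split=> //; rewrite trmx_mul As.
split.
- split=> // v; rewrite -/(bilin A v v).
  have [l hl] := quad_line A b x v.
  suff : 0 <= 2^-1 * bilin A v v by lra.
  apply: (@lead_coef_ge0 _ _ l 0) => t _.
  have := hge (x + t *: v); rewrite hl; lra.
- by exists (- x); rewrite mulmxN AxE opprK.
- have -> : b = - (A *m x) by rewrite AxE opprK.
  move: hx; rewrite /quad.
  have -> : b = - (A *m x) by rewrite AxE opprK.
  (* With b = -Ax, both quadratic expressions reduce to x^T A x, and h(x) = 0 then determines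
     [c]. *)
  have A3x : (A *m x)^T *m A *m (A *m x) = x^T *m A *m x.
    by rewrite trmx_mul As -!mulmxA (mulmxA A A) (mulmxA (A *m A)) A3.
  rewrite mulmxN !linearN /= !mulNmx opprK A3x trmx_mul As.
  rewrite [X in _ + X + _]mxE; lra.
Qed.

(** * Combination of the block conditions *)

Theorem theorem6 (R : realType) (m k p z : nat)
    (sz : 'I_m -> nat) (tau : 'I_m -> R) (kap : 'I_m -> R[i])
    (A D : 'M[R]_(\sum_i sz i + z)) (b e : 'cV[R]_(\sum_i sz i + z)) (c : R)
    (* canonical form *)
    (k_le_p : (k <= p)%N) (p_le_m : (p <= m)%N)
    (sz_gt0 : forall i, (0 < sz i)%N)
    (tau_pm1 : forall i, tau i = 1 \/ tau i = -1)
    (sz_pair : forall i : 'I_m, (i < k)%N -> complex.Im (kap i) != 0 ->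
       ~~ odd (sz i))
    (A_canonical : A = canonical_A p z sz tau)
    (D_canonical : D = canonical_D k p z sz tau kap)
    (* normalization of b *)
    (b_normalized : forall i : 'I_m, (i < p)%N -> sz i = 2%N ->
       ((i < k)%N -> complex.Im (kap i) = 0) ->
       forall j : 'I_(sz i), b (bcoord z i j) 0 = 0)
    (* standing assumption *)
    (P_feasible : exists x, feasible A b c x)
    (P_nondegenerate : forall Ap, moore_penrose A Ap ->
       ~ [/\ psd A, in_range A b & c = 2^-1 * (b^T *m Ap *m b) 0 0])
    (* the optimal value is bounded from below *)
    (P_bounded : bounded_below_on (quad D e) (feasible A b c)) :
  [/\ forall i : 'I_m, (i < p)%N -> (sz i <= 2)%N,
      forall i : 'I_m, (p <= i)%N -> sz i = 1%N &
      forall i : 'I_m, (i < k)%N -> forall w : R[i],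
        eigenvalue (map_mx (real_complex R) (jordan (kap i) (sz i))) w ->
        complex.Im w = 0]
  /\
  (forall (i : 'I_m) (r r' : 'I_(sz i)) (xbar : 'cV[R]_(\sum_i sz i + z)),
     sz i = 2%N -> r = 0%N :> nat -> r' = 1%N :> nat ->
     feasible A b c xbar ->
     let lam := block_lambda k kap i in
     let e1 := e (bcoord z i r) 0 in
     let e2 := e (bcoord z i r') 0 in
     let pi := tau i * xbar (bcoord z i r) 0 * xbar (bcoord z i r') 0 in
     tau i = 1 /\
     [\/ [/\ lam <= 0, e1 = 0 & e2 <> 0],
         [/\ lam = 0, e1 = 0, e2 = 0 & 0 <= pi] |
         [\/ [/\ lam < 0, e1 = 0, e2 = 0 & pi = 0],
             [/\ lam = 0, e1 = 0, e2 = 0 & pi < 0] |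
             [/\ lam < 0, e1 = 0, e2 = 0 & pi <> 0]]]).
Proof.
subst A D.
have [N hN] := P_bounded.
pose BA := A_block p sz tau; pose BD := D_block k p sz tau kap.
have cur i : curvature_cond (BA i) (BD i).
  move=> r s t u v w.
  exact: (@curvature_ge0_block _ _ _ _ BA BD b e c i P_bounded).
have BA_lt (i : 'I_m) : (i < p)%N -> BA i = tau i *: Emx R (sz i).
  by rewrite /BA /A_block => ->.
have BA_ge (i : 'I_m) : (p <= i)%N -> BA i = tau i *: Fmx R (sz i).
  by rewrite /BA /A_block ltnNge => ->.
have BD_ge (i : 'I_m) : (p <= i)%N -> BD i = tau i *: Emx R (sz i).
  by move=> pi; rewrite /BD /D_block ltnNge (leq_trans k_le_p pi) ltnNge pi.
have kap_real (i : 'I_m) : (i < k)%N -> complex.Im (kap i) = 0.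
  move=> ik; apply/eqP; apply: contraT => im0.
  have ip := leq_trans ik k_le_p; have := cur i.
  rewrite BA_lt // /BD /D_block ik /jordan (negPf im0).
  by move/(curvature_complex (tau_pm1 i) (sz_gt0 i) (sz_pair i ik im0))/eqP;
    rewrite (negPf im0).
(* Since E J(0, q) = F, the ranges [i < k] and [k <= i < p] share one formula, with [block_lambda]
   equal to 0 on the second. *)
have BD_lt (i : 'I_m) : (i < p)%N ->
    BD i = tau i *: (block_lambda k kap i *: Emx R (sz i) + Fmx R (sz i)).
  move=> ip; rewrite /BD /D_block /block_lambda; case: ifP => [ik|_].
    by rewrite /jordan kap_real // eqxx Emx_real_jordan.
  by rewrite ip scale0r add0r.
have sz_ge (i : 'I_m) : (p <= i)%N -> sz i = 1%N.
  move=> pi; case: (ltnP 1 (sz i)) => [sz2|]; last by have := sz_gt0 i; lia.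
  have := cur i; rewrite BA_ge // BD_ge //.
  case/(curvature_FE_size (tau_pm1 i)) => // {}sz2 t1.
  have [x1 hx1] : exists x, quad (canonical_A p z sz tau) b x + c < 0.
    apply: slater_point P_feasible P_nondegenerate.
      exact: canonical_A_tr.
    exact: canonical_A_cube.
  have q0 : (0 < sz i)%N by rewrite sz2.
  have q1 : (1 < sz i)%N by rewrite sz2.
  exfalso; pose r := Ordinal q0; pose r' := Ordinal q1.
  have pairA := @quad_pad_diag_pair _ _ z _ BA b x1 i r r' _ _ sz2 erefl erefl.
  have pairD := @quad_pad_diag_pair _ _ z _ BD e x1 i r r' _ _ sz2 erefl erefl.
  move: pairA pairD; rewrite BA_ge // BD_ge // t1 !scale1r !mxE /= sz2 /=.
  (* In the two block coordinates the constraint has only a [v ^+ 2] quadratic term and the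
     objective only a [u * v] term. *)
  move=> pairA pairD; apply: (@parabola_unbounded _ (quad (pad_diag z BA) b x1 + c)
    (b (bcoord z i r) 0) (x1 (bcoord z i r') 0 + b (bcoord z i r') 0)
    (quad (pad_diag z BD) e x1) (x1 (bcoord z i r') 0 + e (bcoord z i r) 0)
    (x1 (bcoord z i r) 0 + e (bcoord z i r') 0) N hx1) => u v huv.
  have := hN (x1 + (u *: basis R (bcoord z i r) + v *: basis R (bcoord z i r'))).
  rewrite /feasible -/(pad_diag z BA) -/(pad_diag z BD) pairA // pairD //.
  by move/(_ ltac:(lra)); lra.
split; first split=> // [i ip|i ik w].
- have := cur i; rewrite BA_lt // BD_lt //; exact: curvature_real_size.
- rewrite /jordan kap_real // eqxx => /eigenvalue_real_jordan -> //.
move=> i r r' xbar sz2 r0 r1 fx lam e1 e2 pi.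
have ip : (i < p)%N by rewrite ltnNge; apply/negP => /sz_ge; rewrite sz2.
have [t1 lam0] : tau i = 1 /\ lam <= 0.
  have := cur i; rewrite BA_lt // BD_lt //; exact: curvature_real_pair.
split=> //.
have e10 : e1 = 0.
  (* As [b] vanishes on this block, h changes only through the product of the two coordinates, so it
     is constant along the hyperbola through [xbar]. *)
  have b0 := b_normalized i ip sz2 (@kap_real i).
  have pairA := @quad_pad_diag_pair _ _ z _ BA b xbar i r r' _ _ sz2 r0 r1.
  have pairD := @quad_pad_diag_pair _ _ z _ BD e xbar i r r' _ _ sz2 r0 r1.
  move: pairA pairD; rewrite BA_lt // BD_lt // t1 !scale1r !mxE /= r0 r1 sz2 !b0 /=.
  rewrite -/lam -/e1 -/e2 => pairA pairD.
  apply: (@hyperbola_bounded _ (xbar (bcoord z i r) 0) (xbar (bcoord z i r') 0)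
    lam e1 e2 (quad (pad_diag z BD) e xbar) (quad (pad_diag z BA) b xbar + c) N fx).
  move=> u v huv.
  have := hN (xbar + (u *: basis R (bcoord z i r) + v *: basis R (bcoord z i r'))).
  rewrite /feasible -/(pad_diag z BA) -/(pad_diag z BD) pairA // pairD //.
  by move/(_ ltac:(lra)); lra.
(* Once [tau i = 1], [e1 = 0] and [lam <= 0] are known, the five alternatives exhaust the cases for
   [e2], [lam] and [pi]. *)
have [e20|/eqP e20] := eqVneq e2 0; last by constructor 1.
have [l0|/eqP l0] := eqVneq lam 0.
  have [pi0|pi0] := leP 0 pi; first by constructor 2.
  by constructor 3; constructor 2.
have {}lam0 : lam < 0 by rewrite lt_neqAle lam0 andbT; apply/eqP.
have [pi0|/eqP pi0] := eqVneq pi 0; constructor 3.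
  by constructor 1.
by constructor 3.
Qed.
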